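(* Let $q\equiv 1\pmod 3$ be a prime and let $N\equiv 1 \pmod 3$ be a positive integer such that $N^2+N+1=kq$ for some positive integer $k$. Let $d$ be a cubefree integer such that $\gcd(N,3d)=1$ and $d^{\frac{N-1}{3}}\not\equiv 1\pmod N$. Let $K=\mathbb{Q}(\sqrt[3]{d})$ with ring of integers $\mathcal{O}_K$, let $\mathcal{R}_N=\mathcal{O}_K/N\mathcal{O}_K$, and let $w\in\mathcal{R}_N^\times$. If $\Phi_q(w^k)=0$ in $\mathcal{R}_N$ and $q>N^{3/2}-1$, then $N$ is prime.
   Context: For a prime $q$, $\Phi_q(x)=x^{q-1}+x^{q-2}+\cdots+x+1$ is the $q$-th cyclotomic polynomial. The data $(q,d,w)$ satisfying these hypotheses is what the paper calls a valid constructive cubic certificate for $N$. *)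

(* Defs.v *)
From HB Require Import structures.
From mathcomp Require Import all_boot all_order all_algebra all_field.
From mathcomp Require Import ring_quotient generic_quotient.
From mathcomp Require Import boolp.

Set Implicit Arguments.
Unset Strict Implicit.
Unset Printing Implicit Defensive.

Import Order.TTheory GRing.Theory Num.Theory.
Local Open Scope ring_scope.
Local Open Scope quotient_scope.

(* The real cube root; 3.-root of a negative number would be non-real. *)
Definition cbrt (d : int) : algC := (sgz d)%:~R * 3.-root (`|d|%N)%:R.

Lemma cbrt_real d : cbrt d \is Num.real.
Proof.
by apply: realM; [exact: realz | rewrite ger0_real // rootC_ge0 ?ler0n].
Qed.

Lemma cbrtK d : cbrt d ^+ 3 = d%:~R.
Proof.
rewrite exprMn rootCK // -rmorphXn /= -[_%:R]/((`|d|%N)%:~R) -rmorphM /=.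
congr (_%:~R); rewrite [RHS]intEsg; congr (_ * _).
by case: sgzP.
Qed.

(* The number field Q(cbrt d): num_field_exists produces a finite extension of
   rat with an embedding into algC whose image is generated by the given
   numbers, see pure_cubic_fieldP. *)
Definition pure_cubic_field (d : int) : fieldExtType rat :=
  tag (num_field_exists [:: cbrt d]).

Lemma pure_cubic_fieldP d :
  exists (iota : {rmorphism pure_cubic_field d -> algC})
         (theta : pure_cubic_field d),
    iota theta = cbrt d /\ <<1; theta>>%VS = fullv.
Proof.
rewrite /pure_cubic_field; case: num_field_exists => K [iota [s Ds genK]] /=.
case: s Ds genK => [|x [|y s]] //= [Dx] genK.
by exists iota, x; split; rewrite // -genK adjoin_seq1.
Qed.

Section RingOfIntegers.

Variable K : fieldExtType rat.

Definition integer_pred : {pred K} :=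
  fun x => `[< integralOver (intr : int -> K) x >].

Lemma integer_predP x :
  reflect (integralOver (intr : int -> K) x) (x \in integer_pred).
Proof. exact: asboolP. Qed.

Fact integer_pred_subring : subring_closed integer_pred.
Proof.
split=> [|x y /integer_predP xI /integer_predP yI
         |x y /integer_predP xI /integer_predP yI]; apply/integer_predP.
- exact: integral1.
- exact: integral_sub.
- exact: integral_mul.
Qed.

HB.instance Definition _ :=
  GRing.isSubringClosed.Build K integer_pred integer_pred_subring.

Record ring_of_integers := RingOfIntegers {
  integer_val :> K;
  _ : integer_val \in integer_pred
}.

HB.instance Definition _ := [isSub for integer_val].
HB.instance Definition _ := [Choice of ring_of_integers by <:].
HB.instance Definition _ :=
  [SubChoice_isSubComNzRing of ring_of_integers by <:].

End RingOfIntegers.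

(* The quotient A / nA. MathComp's {ideal_quot I} is only a ring for a proper
   ideal I; here nA may be all of A, so the ring structure is put on the
   Z-module quotient {quot I}, possibly yielding the zero ring. *)
Section Residues.

Variables (A : comNzRingType) (n : nat).

Definition multiples : {pred A} := fun x => `[< exists y, x = n%:R * y >].

Lemma multiplesP x : reflect (exists y, x = n%:R * y) (x \in multiples).
Proof. exact: asboolP. Qed.

Fact multiples_zmod : zmod_closed multiples.
Proof.
split=> [|x y /multiplesP[a ->] /multiplesP[b ->]]; apply/multiplesP.
  by exists 0; rewrite mulr0.
by exists (a - b); rewrite mulrBr.
Qed.

HB.instance Definition _ := GRing.isZmodClosed.Build A multiples multiples_zmod.

Definition residue_ring := Quotient.quot multiples.

HB.instance Definition _ := GRing.Zmodule.on residue_ring.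
HB.instance Definition _ := EqQuotient.on residue_ring.

Definition residue (x : A) : residue_ring := \pi x.

Definition residue_one : residue_ring := residue 1.

Definition residue_mul (u v : residue_ring) : residue_ring :=
  residue (repr u * repr v).

Lemma residueP x y : residue x = residue y <-> x - y \in multiples.
Proof.
rewrite /residue; split=> [/eqP|xy]; first by rewrite -Quotient.idealrBE.
by apply/eqP; rewrite -Quotient.idealrBE.
Qed.

Lemma residueK u : residue (repr u) = u.
Proof. exact: reprK. Qed.

Lemma residue_mulE x y : residue_mul (residue x) (residue y) = residue (x * y).
Proof.
have /residueP/multiplesP[a Da] := residueK (residue x).
have /residueP/multiplesP[b Db] := residueK (residue y).
apply/residueP/multiplesP; exists (a * repr (residue y) + x * b).
by rewrite mulrDr mulrA mulrCA -Da -Db mulrBl mulrBr addrA subrK.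
Qed.

Lemma residueD x y : residue (x + y) = residue x + residue y.
Proof. exact: raddfD. Qed.

Fact residue_mulA : associative residue_mul.
Proof.
move=> u v w; rewrite -(residueK u) -(residueK v) -(residueK w).
by rewrite !residue_mulE mulrA.
Qed.

Fact residue_mulC : commutative residue_mul.
Proof. by move=> u v; rewrite /residue_mul mulrC. Qed.

Fact residue_mul1 : left_id residue_one residue_mul.
Proof. by move=> u; rewrite -(residueK u) residue_mulE mul1r. Qed.

Fact residue_mulDl : left_distributive residue_mul +%R.
Proof.
move=> u v w; rewrite -(residueK u) -(residueK v) -(residueK w).
by rewrite -residueD !residue_mulE mulrDl residueD.
Qed.

HB.instance Definition _ := GRing.Zmodule_isComPzRing.Build residue_ring
  residue_mulA residue_mulC residue_mul1 residue_mulDl.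

End Residues.

Definition invertible (R : comPzRingType) (w : R) := exists v : R, w * v = 1.

Definition cubefree (d : int) :=
  forall p : nat, prime p -> ~~ ((p ^ 3)%N%:Z %| d)%Z.

(* Horner evaluation requires a nontrivial ring, and A / nA may be trivial. *)
Definition Phi (R : pzRingType) (q : nat) (x : R) : R := \sum_(i < q) x ^+ i.

Lemma Phi_Cyclotomic (R : nzRingType) (q : nat) (x : R) :
  prime q -> Phi q x = (map_poly intr 'Phi_q).[x].
Proof.
move=> q_pr; have q_gt1 := prime_gt1 q_pr.
have D1: 'Phi_1 = 'X - 1 :> {poly int}.
  by have := prod_Cyclotomic (isT : 0 < 1)%N; rewrite big_seq1 expr1.
have divq: perm_eq (divisors q) [:: 1%N; q].
  apply: uniq_perm; rewrite ?divisors_uniq //= ?inE ?andbT ?ltn_eqF // => m.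
  have <- := dvdn_divisors m (ltnW q_gt1).
  rewrite !inE; have /primeP[_ min_q] := q_pr.
  by apply/idP/idP => [/min_q | /orP[]/eqP->] //; rewrite dvd1n.
have := prod_Cyclotomic (ltnW q_gt1).
rewrite (perm_big _ divq) big_cons big_seq1 D1 subrX1 => Dq.
have /mulfI/(_ _ _ Dq)->: 'X - 1 != 0 :> {poly int} by rewrite polyXsubC_eq0.
rewrite rmorph_sum horner_sum; apply: eq_bigr => i _.
by rewrite /= map_polyXn hornerXn.
Qed.

(* Main.v *)
Require Import Defs.
From mathcomp Require Import all_boot all_order all_algebra all_field.
From mathcomp Require Import boolp.

Import Order.TTheory GRing.Theory Num.Theory.
Local Open Scope ring_scope.

(** If N > 1 were composite, its least prime factor p would satisfy p ^ 2 <= N.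
    Reduce the certificate from O_K / N to V = O_K / p and let y be the image
    of w ^ k. Since Phi_q(y) = 0, we have y ^ q = 1. Moreover y <> 1: otherwise
    Phi_q(1) = q would vanish in V, whereas q is prime to p (as q divides
    N ^ 2 + N + 1) and V is not the zero ring ([residue_ring_nontrivial]). As q
    is prime, 1, y, ..., y ^ (q - 1) are distinct units, so that together with
    0 they are q + 1 distinct elements of V ([prime_order_powers_inj]).

    On the other hand V has at most p ^ 3 elements: since [K : Q] <= 3, any
    four elements of O_K satisfy a rational linear relation, which can be
    scaled to have coprime integer coefficients and therefore remains
    nontrivial modulo p ([dependent_residues]). Hence V is an F_p-space of
    dimension at most 3 ([card_mod_prime]). Therefore
    q + 1 <= p ^ 3 <= N ^ (3/2), against the lower bound on q. *)

(** When p V = 0 this is linear dependence over F_p; integer coefficients let a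
    relation between elements of O_K pass to their residues unchanged. *)
Definition dependent_mod (p : nat) {V : zmodType} {m : nat} (e : 'I_m -> V) :=
  exists2 c : 'I_m -> int,
    exists i, ~~ (p%:Z %| c i)%Z & \sum_i e i *~ c i = 0.

(** By induction on n, V is spanned by an independent family of largest size: a
    relation between that family and a further vector x has a coefficient
    invertible mod p at x, and can be solved for x. *)
Lemma span_mod_prime {p : nat} {V : zmodType} {n : nat} :
  prime p -> (forall x : V, x *+ p = 0) ->
  (forall e : 'I_n.+1 -> V, dependent_mod p e) ->
  exists2 m, (m <= n)%N &
    exists e : 'I_m -> V, forall x, exists g : {ffun 'I_m -> 'I_p},
      x = \sum_i e i *+ g i.
Proof.
move=> p_pr Vp.
have Vpz (x : V) z : x *~ (z * p%:Z) = 0 by rewrite mulrzA -pmulrn Vp.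
elim: n => [|n IHn] depV.
  exists 0%N => //; exists (fun=> 0) => x.
  exists [ffun=> Ordinal (prime_gt0 p_pr)].
  rewrite big_ord0.
  have [c [i]] := depV (fun=> x); rewrite big_ord1 ord1 {i} => ndvd xc0.
  have /coprimezP[[u v] /= uv1]: coprimez p%:Z (c ord0).
    by rewrite coprimezE /= prime_coprime.
  by rewrite -[x]mulr1z -uv1 mulrzDr Vpz add0r mulrC mulrzA xc0 mul0rz.
have [depn|/existsNP[e indep]] :=
  pselect (forall e : 'I_n.+1 -> V, dependent_mod p e).
  by have [m le_mn gen] := IHn depn; exists m => //; apply: leqW.
exists n.+1 => //; exists e => x.
(* The vector x sits at index 0 and the family e at the lifted indices. *)
have [c [i ndvd]] := depV (fun i => oapp e x (unlift ord0 i)).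
rewrite big_ord_recl unlift_none /=.
under eq_bigr => j _ do rewrite liftK /=.
move=> rel.
have ndvd0: ~~ (p%:Z %| c ord0)%Z.
  apply/negP => /dvdzP[b Dc0]; apply: indep; exists (fun j => c (lift ord0 j)).
    case: (unliftP ord0 i) ndvd => [j ->|->]; first by exists j.
    by rewrite Dc0 dvdz_mull.
  by move: rel; rewrite Dc0 Vpz add0r.
have /coprimezP[[u v] /= uv1]: coprimez p%:Z (c ord0).
  by rewrite coprimezE /= prime_coprime.
(* With v the inverse of c ord0 mod p, x is the sum of the - v c_j e_j; r j is
   the representative of - v c_j in [0, p). *)
pose r j := ((- v * c (lift ord0 j)) %% p)%Z.
have p0: p%:Z != 0 by rewrite eqz_nat -lt0n prime_gt0.
have r_ge0 j: 0 <= r j by apply: modz_ge0.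
have r_lt j: (`|r j| < p)%N.
  by rewrite -ltz_nat gez0_abs ?r_ge0 // ltz_pmod // ltz_nat prime_gt0.
exists [ffun j => Ordinal (r_lt j)].
under eq_bigr => j _.
  rewrite ffunE /= pmulrn gez0_abs ?r_ge0 //.
  have ->: e j *~ r j = e j *~ (- v * c (lift ord0 j)).
    rewrite [in RHS](divz_eq (- v * _) p) [RHS]mulrzDr Vpz.
    by rewrite add0r.
  rewrite mulrC mulrzA; over.
rewrite -mulrz_suml.
rewrite -[LHS]mulr1z -uv1 mulrzDr Vpz add0r.
rewrite mulrC mulrzA mulrNz -mulNrz; congr (_ *~ _).
by apply/eqP; rewrite -addr_eq0 rel.
Qed.

Lemma card_mod_prime {p : nat} {V : zmodType} {n : nat} {T : finType}
    {f : T -> V} :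
  prime p -> (forall x : V, x *+ p = 0) ->
  (forall e : 'I_n.+1 -> V, dependent_mod p e) ->
  injective f -> (#|T| <= p ^ n)%N.
Proof.
move=> p_pr Vp depV injf.
have [m le_mn [e /(_ (f _)) gen_e]] := span_mod_prime p_pr Vp depV.
have [h Dh] := fin_all_exists gen_e.
have injh: injective h by move=> t1 t2 eq_h; apply: injf; rewrite !Dh eq_h.
rewrite (leq_trans (leq_card h injh)) // card_ffun !card_ord.
by rewrite leq_pexp2l // prime_gt0.
Qed.

(** A rational relation can be scaled to have coprime integer coefficients. The
    coefficients are packed into a polynomial so that Gauss's primitive part
    does the scaling. *)
Lemma dependent_mod_rat {p : nat} {K : vectType rat} {n : nat}
    (e : 'I_n -> K) :
  prime p -> (\dim (fullv : {vspace K}) < n)%N -> dependent_mod p e.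
Proof.
move=> p_pr; case: n e => // n e ltKn; apply: contrapT => indep.
suff /eqP free_e: free [tuple e i | i < n.+1].
  by have := dimvS (subvf <<[tuple e i | i < n.+1]>>%VS);
     rewrite free_e size_tuple leqNgt ltKn.
apply/freeP => k rel i; apply/eqP/contraT => ki0; case: indep.
pose P := \poly_(j < n.+1) k (inord j).
have [Q [a a0 DP]] := rat_poly_scale P.
pose b : rat := (zcontents Q)%:~R / a%:~R; pose S := zprimitive Q.
have DPj j: P`_j = b * (S`_j)%:~R.
  rewrite DP coefZ coef_map /= [in LHS](zpolyEprim Q) coefZ rmorphM /=.
  by rewrite mulrCA mulrA.
have Dk j : k j = b * (S`_j)%:~R by rewrite -DPj coef_poly ltn_ord inord_val.
have b0: b != 0 by apply: contraNneq ki0 => b0; rewrite Dk b0 mul0r.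
exists (fun j => S`_j).
  apply: contrapT => alldvd.
  have: (p%:Z %| zcontents S)%Z.
    rewrite dvdz_contents; apply/polyOverP => j.
    have [ltjn|lenj] := ltnP j n.+1.
      by apply: contraPT alldvd => ndvd; apply; exists (Ordinal ltjn).
    have /eqP := DPj j; rewrite coef_poly ltnNge lenj eq_sym mulf_eq0.
    by rewrite (negPf b0) /= intr_eq0 => /eqP->; apply: dvdz0.
  rewrite zcontents_primitive; case: eqP => [Q0|_].
    by case/eqP: b0; rewrite /b Q0 zcontents0 mul0r.
  by rewrite dvdz1 /= => /eqP p1; rewrite p1 in p_pr.
apply: (scalerI b0); rewrite scaler0 -[RHS]rel scaler_sumr.
apply: eq_bigr => j _.
by rewrite Dk -tnth_nth tnth_mktuple -scaler_int scalerA.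
Qed.

Lemma dependent_residues {p : nat} {K : fieldExtType rat} {n : nat}
    (e : 'I_n -> residue_ring (ring_of_integers K) p) :
  prime p -> (\dim (fullv : {vspace K}) < n)%N -> dependent_mod p e.
Proof.
move=> p_pr ltKn.
have [c ndvd rel] :=
  dependent_mod_rat (fun i => integer_val (repr (e i))) p_pr ltKn.
exists c => //.
have {}rel: \sum_i repr (e i) *~ c i = 0.
  apply: val_inj; rewrite raddf_sum raddf0 -[RHS]rel; apply: eq_bigr => i _.
  by rewrite raddfMz.
transitivity (residue p (\sum_i repr (e i) *~ c i)).
  rewrite /residue raddf_sum; apply: eq_bigr => i _.
  by rewrite -[in LHS](residueK (e i)) raddfMz.
by rewrite rel /residue raddf0.
Qed.

(** The generator is a root of X^3 - d; equality fails when d is a cube. *)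
Lemma pure_cubic_field_dim (d : int) :
  (\dim (fullv : {vspace pure_cubic_field d}) <= 3)%N.
Proof.
have [iota [theta [Dtheta <-]]] := pure_cubic_fieldP d.
have theta3: theta ^+ 3 = d%:~R.
  by apply: (fmorph_inj iota); rewrite rmorphXn /= Dtheta cbrtK rmorph_int.
rewrite dim_Fadjoin dimv1 muln1 -ltnS -size_minPoly.
have p0: 'X^3 - (d%:~R)%:P != 0 :> {poly pure_cubic_field d}.
  by rewrite -size_poly_eq0 size_XnsubC.
rewrite -(size_XnsubC (d%:~R : pure_cubic_field d) (isT : 0 < 3)%N).
apply: dvdp_leq => //; apply: minPoly_dvdp.
  by rewrite rpredB ?rpredX ?polyOverX // polyOverC rpred_int.
by rewrite /root !hornerE theta3 subrr.
Qed.

(** Z is integrally closed in Q; this is transported along Q -> algC from the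
    corresponding fact on algebraic integers. *)
Lemma integral_rat {K : fieldExtType rat} {r : rat} :
  integralOver (intr : int -> K) r%:A -> r \is a Num.int.
Proof.
case=> f f_mon f_r.
have {}f_r: root (map_poly (intr : int -> algC) f) (ratr r).
  have ->: map_poly (intr : int -> algC) f =
            map_poly ratr (map_poly (intr : int -> rat) f).
    by rewrite -map_poly_comp; apply: eq_map_poly => i /=; rewrite ratr_int.
  rewrite fmorph_root -(fmorph_root (in_alg K)) -map_poly_comp.
  by rewrite (eq_map_poly (g := intr)) // => i /=; rewrite scaler_int.
have: ratr r \in Aint.
  apply: root_monic_Aint f_r _ _; first by rewrite monic_map.
  by apply/polyOverP => i; rewrite coef_map /=.
move/(Cint_rat_Aint (Crat_rat r))/intrP => [m].
by rewrite -(ratr_int _ m) => /fmorph_inj->; apply: intr_int.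
Qed.

(** If 1 were a multiple of n in O_K, then 1/n would be an algebraic integer. *)
Lemma residue_ring_nontrivial (K : fieldExtType rat) (n : nat) :
  (1 < n)%N -> 1 <> 0 :> residue_ring (ring_of_integers K) n.
Proof.
move=> n_gt1 one0.
have /residueP/multiplesP[y] : residue n 0 = residue n (1 : ring_of_integers K).
  by rewrite {1}/residue raddf0 -one0.
rewrite sub0r => Dy.
have n0: n%:R != 0 :> rat by rewrite pnatr_eq0 -lt0n ltnW.
have Dval: - integer_val y = (n%:R^-1 : rat)%:A.
  apply: (scalerI n0); rewrite scalerA mulfV // scale1r scalerN.
  apply: oppr_inj; rewrite opprK.
  move/(congr1 val): Dy; rewrite rmorphN rmorph1 rmorphM rmorph_nat /= => ->.
  by rewrite scaler_nat mulr_natl.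
have: (n%:R^-1 : rat) \is a Num.int.
  apply: (@integral_rat K); rewrite -Dval.
  by apply/integer_predP; rewrite rpredN; apply: valP.
move/intrP => [m] Dm.
have: n%:Z * m = 1.
  by apply: (@intr_inj rat); rewrite rmorphM /= -Dm mulfV.
move/(congr1 absz)/eqP; rewrite abszM muln_eq1 /= => /andP[/eqP n1].
by rewrite n1 in n_gt1.
Qed.

Lemma Phi_root_expr {R : pzRingType} {q : nat} {y : R} :
  Phi q y = 0 -> y ^+ q = 1.
Proof.
by move=> y0; apply/eqP; rewrite -subr_eq0 subrX1 -/(Phi q y) y0 mulr0.
Qed.

(** An exponent m with 0 < m < q is prime to q, so y ^ m = 1 would give y = 1 by
    Bezout. *)
Lemma prime_order_powers_inj {R : comPzRingType} {q : nat} {y : R} :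
  prime q -> y ^+ q = 1 -> y <> 1 -> injective (fun i : 'I_q => y ^+ i).
Proof.
move=> q_pr yq y1.
have Xnot1 m : (0 < m < q)%N -> y ^+ m <> 1.
  move=> /andP[m_gt0 lt_mq] ym; apply: y1.
  have/eqP co: coprime q m by rewrite prime_coprime // gtnNdvd.
  case: (egcdnP m (prime_gt0 q_pr)) => u v; rewrite co => uv _.
  have := congr1 (fun s => y ^+ s) uv.
  by rewrite exprD mulnC [(v * m)%N]mulnC !exprM yq ym !expr1n mul1r.
suff lt_inj (i j : 'I_q) : (i < j)%N -> y ^+ i <> y ^+ j.
  move=> i j /= eqy; apply/val_inj/eqP; case: ltngtP => // /lt_inj; first by [].
  by rewrite eqy.
move=> lt_ij eqy; apply: (Xnot1 (j - i)%N).
  by rewrite subn_gt0 lt_ij (leq_ltn_trans (leq_subr _ _)).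
have unit_yi : y ^+ (q - i) * y ^+ i = 1 by rewrite -exprD subnK // ltnW.
by rewrite -[LHS]mul1r -{1}unit_yi -mulrA -exprD subnKC ?(ltnW lt_ij) // -eqy.
Qed.

(** For p dividing N, a representative of w modulo N carries the root over to
    A / pA, because multiples of N are multiples of p. *)
Lemma Phi_residue_descent {A : comNzRingType} {N p q k : nat}
    {w : residue_ring A N} :
  (p %| N)%N -> Phi q (w ^+ k) = 0 ->
  Phi q (residue p (repr w) ^+ k) = 0.
Proof.
have residueX n (x : A) i : residue n x ^+ i = residue n (x ^+ i).
  by elim: i => // i IHi; rewrite !exprS IHi [LHS]residue_mulE.
have PhiE n (x : A) : Phi q (residue n x ^+ k) = residue n (Phi q (x ^+ k)).
  rewrite /Phi /residue raddf_sum; apply: eq_bigr => i _.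
  by rewrite -!exprM residueX.
have residue0 n : residue n (0 : A) = 0 by rewrite /residue raddf0.
case/dvdnP=> m DN; rewrite -{1}(residueK w) !PhiE -(residue0 N) -(residue0 p).
move/residueP/multiplesP=> [a Da]; apply/residueP/multiplesP; exists (m%:R * a).
by rewrite Da DN natrM mulrCA mulrA.
Qed.

Theorem theorem5p1 (q N k : nat) (d : int)
    (w : residue_ring (ring_of_integers (pure_cubic_field d)) N) :
  prime q -> (q = 1 %[mod 3])%N ->
  (0 < N)%N -> (N = 1 %[mod 3])%N ->
  (0 < k)%N -> (N ^ 2 + N + 1 = k * q)%N ->
  cubefree d ->
  gcdz N (3 * d) = 1 ->
  (d ^+ ((N - 1) %/ 3)%N <> 1 %[mod N])%Z ->
  invertible w ->
  Phi q (w ^+ k) = 0 ->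
  sqrtC N%:R ^+ 3 - 1 < q%:R :> algC ->
  prime N.
Proof.
move=> q_pr _ N_gt0 _ _ DN _ _ d_nres _ w_root q_large.
(* Modulo 1 the condition on d could not hold. *)
have N_gt1 : (1 < N)%N.
  by case: N N_gt0 {w DN w_root q_large} d_nres => [|[|N]] // _ [].
apply: contraT => N_npr.
pose p := pdiv N; have p_pr : prime p := pdiv_prime N_gt1.
have le_p2N : (p ^ 2 <= N)%N.
  by rewrite leqNgt; apply: contra N_npr; apply: ltn_pdiv2_prime.
have lt_p3q : (p ^ 3 < q.+1)%N.
  have: p%:R ^+ 3 <= sqrtC N%:R ^+ 3 :> algC.
    rewrite lerXn2r ?nnegrE ?sqrtC_ge0 ?ler0n //.
    rewrite -(@ler_pXn2r _ 2) ?nnegrE ?sqrtC_ge0 ?ler0n //.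
    by rewrite sqrtCK -natrX ler_nat.
  move=> /le_lt_trans lt_p3; move: q_large; rewrite ltrBlDr => /lt_p3.
  by rewrite -natrX -[1]/(1%:R) -natrD ltr_nat addn1.
have co_qp : coprime q p.
  rewrite coprime_sym prime_coprime //; apply/negP => dvd_pq.
  have dvd_pN : (p %| N)%N := pdiv_dvd N.
  have := dvdn_mull k dvd_pq; rewrite -DN dvdn_addr; last first.
    by rewrite dvdn_add // (dvdn_exp (isT : 0 < 2)%N).
  by rewrite dvdn1 => /eqP p1; rewrite p1 in p_pr.
pose V := residue_ring (ring_of_integers (pure_cubic_field d)) p.
have one_neq0 : 1 <> 0 :> V := @residue_ring_nontrivial _ p (prime_gt1 p_pr).
have Vp (x : V) : x *+ p = 0.
  have ->: x = residue p (repr x) by rewrite residueK.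
  rewrite -[RHS](raddf0 (residue p)) -raddfMn.
  apply/residueP/multiplesP; exists (repr x).
  by rewrite subr0 mulr_natl.
pose y : V := residue p (repr w) ^+ k.
have y_root : Phi q y = 0 := Phi_residue_descent (pdiv_dvd N) w_root.
have yq := Phi_root_expr y_root.
have y_neq1 : y <> 1.
  move=> y1; move: y_root; rewrite y1 /Phi.
  under eq_bigr => i _ do rewrite expr1n.
  rewrite sumr_const card_ord => q0; apply: one_neq0.
  have /eqP co := co_qp.
  case: (egcdnP p (prime_gt0 q_pr)) => a b; rewrite co => ab _.
  have := congr1 (fun n => 1 *+ n : V) ab.
  rewrite mulrnDr mulnC [(b * p)%N]mulnC !mulrnA q0 Vp !mul0rn add0r.
  by move/esym.
pose f (t : option 'I_q) : V := if t is Some i then y ^+ i else 0.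
have inj_f : injective f.
  have X_neq0 (i : 'I_q) : y ^+ i <> 0.
    move=> yi0; apply: one_neq0.
    have <- : y ^+ (q - i) * y ^+ i = 1 by rewrite -exprD subnK // ltnW.
    by rewrite yi0 mulr0.
  move=> [i|] [j|] //=.
  - by move/(prime_order_powers_inj q_pr yq y_neq1)->.
  - by move/X_neq0.
  - by move/esym/X_neq0.
have le_dim := pure_cubic_field_dim d.
have dep_V (e : 'I_4 -> V) := dependent_residues e p_pr le_dim.
have := card_mod_prime p_pr Vp dep_V inj_f.
by rewrite card_option card_ord leqNgt lt_p3q.
Qed.
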